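(* Let $D$ and $D'$ be two closed Condorcet domains. Then the associated graphs $G_D$ and $G_{D'}$ are isomorphic if and only if $\varphi(D)$ and $\varphi(D')$ are skeleton isomorphic.
   Context: Let $\Phi$ be a finite root system in a real Euclidean space (a finite set of nonzero vectors with $\Phi\cap\mathbb{R}\alpha=\{\alpha,-\alpha\}$ and $s_\alpha(\Phi)=\Phi$ for all $\alpha\in\Phi$, where $s_\alpha$ is the orthogonal reflection in $\alpha^\perp$; not necessarily crystallographic). Let $\Phi^+$ be a choice of positive roots, $\Phi^-=\Phi\setminus\Phi^+$, and let $W=W(\Phi)$ be the finite Coxeter group generated by the $s_\alpha$. For $w\in W$, the (left) inversion set is $I(w):=\{\alpha\in\Phi\mid w^{-1}\alpha\in\Phi^-\}$ (negative roots are allowed, so exactly one of $\alpha,-\alpha$ lies in $I(w)$). A set of three roots $\{\alpha,\beta,\gamma\}\subseteq\Phi$ is a root-triple if there exist real $a,b,c>0$ with $a\alpha+b\beta+c\gamma=0$. A nonempty subset $D\subseteq W$ is a Condorcet domain if there do not exist distinct $u,v,w\in D$ and a root-triple $\{\alpha,\beta,\gamma\}$ such that $\alpha,\beta\in I(u)$, $\alpha,\gamma\in I(v)$, $\beta,\gamma\in I(w)$. A voting profile on $D$ is a map $f:D\to\mathbb{Z}_{\ge0}$, not constantly zero. Put $f(\alpha)=\sum_{w\in D,\ \alpha\in I(w)}f(w)$ for $\alpha\in\Phi$, $|f|=\sum_{w\in D}f(w)$, $I(f)=\{\alpha\in\Phi\mid f(\alpha)\ge|f|/2\}$ and $R(f)=\{w\in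 W\mid I(w)\subseteq I(f)\}$. $f$ has no tie if $f(\alpha)\ne|f|/2$ for all $\alpha\in\Phi$. Let $\nu(D)=\bigcup_f R(f)$ over all voting profiles $f$ on $D$ with no tie. A Condorcet domain $D$ is closed if $\nu(D)=D$ (equivalently $\nu(D)\subseteq D$). Two distinct elements $v_1,v_2\in D$ are neighbors if there is no $v\in D\setminus\{v_1,v_2\}$ with $I(v)\supseteq I(v_1)\cap I(v_2)$. The associated graph $G_D$ is the simple graph with vertex set $D$ whose edges are the pairs of neighbors. A preposet is a set with a reflexive transitive relation $\le$, not necessarily antisymmetric; $x=y$ in $P$ means $x\le y$ and $y\le x$. For nonempty $D\subseteq W$ and $\gamma\in\Phi$ let $D(\gamma)=\{v\in D\mid\gamma\in I(v)\}$; $\varphi(D)$ is the preposet on the set $\Phi$ with $\alpha\le\beta$ if and only if $D(\alpha)\supseteq D(\beta)$. For a preposet $P$ on $\Phi$ let $P_m$ be its set of minimum elements ($\gamma$ with $\gamma\le\delta$ for all $\delta$) and $P_M$ its set of maximum elements, $P_G=P_m\cup P_M$, and let the skeleton be $\tilde P=P\setminus P_G$ with the induced relation. A map $\chi:P\to P'$ of preposets is an order equivalence if $a\le_P b\iff\chi(a)\le_{P'}\chi(b)$ for all $a,b\in P$, and for every $y\in P'$ there is $x\in P$ with $\chi(x)=y$ in $P'$ (equal in the preposet sense). The preposets $P_1=\varphi(D)$ and $P_2=\varphi(D')$ on $\Phi$ are skeleton isomorphic if there is an order equivalence $\chi:\tilde P_1\to\tilde P_2$ such that $\chi(-\alpha)=-\chi(\alpha)$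 (in $P_2$) for all $\alpha\in\tilde P_1$. *)

(* Defs.v *)
From mathcomp Require Import all_boot all_order all_algebra finmap.
From mathcomp Require Import boolp classical_sets reals.
Set Implicit Arguments.
Unset Strict Implicit.
Unset Printing Implicit Defensive.
Import Order.TTheory GRing.Theory Num.Theory.
Local Open Scope classical_set_scope.
Local Open Scope ring_scope.

Definition dot (R : realType) (n : nat) (u v : 'cV[R]_n) : R :=
  \sum_(i < n) u i 0 * v i 0.

(* The matrix of x |-> x - 2 (x . a) / (a . a) a. *)
Definition reflection (R : realType) (n : nat) (a : 'cV[R]_n) : 'M[R]_n :=
  1%:M - (2 / dot a a) *: (a *m a^T).

Definition root_system (R : realType) (n : nat) (Phi : {fset 'cV[R]_n}) : Prop :=
  [/\ 0 \notin Phi,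
      (forall a, a \in Phi ->
         [set` Phi] `&` range (fun c : R => c *: a) = [set a; - a]) &
      (forall a, a \in Phi -> [fset reflection a *m b | b in Phi]%fset = Phi)].

(* A choice of positive roots is the part of Phi lying strictly on one side
   of a hyperplane that contains no root. *)
Definition positive_system (R : realType) (n : nat)
    (Phi Pos : {fset 'cV[R]_n}) : Prop :=
  exists2 l : 'cV[R]_n,
    (forall a, a \in Phi -> dot l a != 0) &
    Pos = [fset a in Phi | 0 < dot l a]%fset.

(* The generators are involutions, so the group they generate is the set of
   their finite products. *)
Definition coxeter_group (R : realType) (n : nat)
    (Phi : {fset 'cV[R]_n}) : set 'M[R]_n :=
  [set w | exists2 s : seq 'cV[R]_n, {subset s <= Phi} &
           w = \big[mulmx/1%:M]_(a <- s) reflection a].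

Definition inv_set (R : realType) (n : nat) (Phi Pos : {fset 'cV[R]_n})
    (w : 'M[R]_n) : {fset 'cV[R]_n} :=
  [fset a in Phi | invmx w *m a \in (Phi `\` Pos)%fset]%fset.

Definition root_triple (R : realType) (n : nat) (Phi : {fset 'cV[R]_n})
    (a b c : 'cV[R]_n) : Prop :=
  [/\ a \in Phi, b \in Phi & c \in Phi] /\ [/\ a != b, a != c & b != c] /\
  exists x y z : R,
    [/\ 0 < x, 0 < y & 0 < z] /\ x *: a + y *: b + z *: c = 0.

(* Taking D finite is no restriction, since the Coxeter group is finite. *)
Definition condorcet_domain (R : realType) (n : nat) (Phi Pos : {fset 'cV[R]_n})
    (D : {fset 'M[R]_n}) : Prop :=
  [/\ D != fset0,
      [set` D] `<=` coxeter_group Phi &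
      ~ exists u v w : 'M[R]_n, exists a b c : 'cV[R]_n,
          [/\ u \in D, v \in D & w \in D] /\
          [/\ u != v, u != w & v != w] /\
          root_triple Phi a b c /\
          [/\ a \in inv_set Phi Pos u /\ b \in inv_set Phi Pos u,
              a \in inv_set Phi Pos v /\ c \in inv_set Phi Pos v &
              b \in inv_set Phi Pos w /\ c \in inv_set Phi Pos w]].

Definition voting_profile (R : realType) (n : nat) (D : {fset 'M[R]_n})
    (f : D -> nat) : Prop :=
  exists w : D, f w <> 0%N.

Definition votes (R : realType) (n : nat) (Phi Pos : {fset 'cV[R]_n})
    (D : {fset 'M[R]_n}) (f : D -> nat) (a : 'cV[R]_n) : nat :=
  (\sum_(w : D | a \in inv_set Phi Pos (val w)) f w)%N.

Definition total_votes (R : realType) (n : nat) (D : {fset 'M[R]_n})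
    (f : D -> nat) : nat :=
  (\sum_(w : D) f w)%N.

Definition majority_set (R : realType) (n : nat) (Phi Pos : {fset 'cV[R]_n})
    (D : {fset 'M[R]_n}) (f : D -> nat) : {fset 'cV[R]_n} :=
  [fset a in Phi |
    (total_votes f)%:R / 2 <= (votes Phi Pos f a)%:R :> R]%fset.

Definition majority_results (R : realType) (n : nat)
    (Phi Pos : {fset 'cV[R]_n}) (D : {fset 'M[R]_n}) (f : D -> nat) :
    set 'M[R]_n :=
  [set w | coxeter_group Phi w /\
           (inv_set Phi Pos w `<=` majority_set Phi Pos f)%fset].

Definition no_tie (R : realType) (n : nat) (Phi Pos : {fset 'cV[R]_n})
    (D : {fset 'M[R]_n}) (f : D -> nat) : Prop :=
  forall a, a \in Phi ->
    (votes Phi Pos f a)%:R <> (total_votes f)%:R / 2 :> R.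

Definition nu (R : realType) (n : nat) (Phi Pos : {fset 'cV[R]_n})
    (D : {fset 'M[R]_n}) : set 'M[R]_n :=
  \bigcup_(f in [set f : D -> nat | voting_profile f /\ no_tie Phi Pos f])
    majority_results Phi Pos f.

Definition closed_condorcet_domain (R : realType) (n : nat)
    (Phi Pos : {fset 'cV[R]_n}) (D : {fset 'M[R]_n}) : Prop :=
  condorcet_domain Phi Pos D /\ nu Phi Pos D = [set` D].

Definition neighbors (R : realType) (n : nat) (Phi Pos : {fset 'cV[R]_n})
    (D : {fset 'M[R]_n}) : rel D :=
  fun v1 v2 => (v1 != v2) &&
    ~~ [exists v : D, [&& v != v1, v != v2 &
          (inv_set Phi Pos (val v1) `&` inv_set Phi Pos (val v2)
             `<=` inv_set Phi Pos (val v))%fset]].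

Definition graph_isomorphic (T T' : finType) (e : rel T) (e' : rel T') : Prop :=
  exists2 g : T -> T', bijective g & forall x y, e' (g x) (g y) = e x y.

Record preposet (K : choiceType) := Preposet {
  carrier : {fset K};
  ple : rel K;
  ple_refl : {in carrier, reflexive ple};
  ple_trans : {in carrier & &, transitive ple} }.

Definition peq (K : choiceType) (P : preposet K) (x y : K) : bool :=
  ple P x y && ple P y x.

Definition minimums (K : choiceType) (P : preposet K) : {fset K} :=
  [fset x in carrier P | [forall y : carrier P, ple P x (val y)]]%fset.

Definition maximums (K : choiceType) (P : preposet K) : {fset K} :=
  [fset x in carrier P | [forall y : carrier P, ple P (val y) x]]%fset.

Definition skeleton_carrier (K : choiceType) (P : preposet K) : {fset K} :=
  (carrier P `\` (minimums P `|` maximums P))%fset.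

Lemma skeleton_refl (K : choiceType) (P : preposet K) :
  {in skeleton_carrier P, reflexive (ple P)}.
Proof. by move=> x /fsetDP[xP _]; exact: ple_refl. Qed.

Lemma skeleton_trans (K : choiceType) (P : preposet K) :
  {in skeleton_carrier P & &, transitive (ple P)}.
Proof.
by move=> y x z /fsetDP[yP _] /fsetDP[xP _] /fsetDP[zP _]; exact: ple_trans.
Qed.

Definition skeleton (K : choiceType) (P : preposet K) : preposet K :=
  Preposet (@skeleton_refl K P) (@skeleton_trans K P).

(* Maps between preposets are total functions on the ambient type; only their
   values on the carrier of the source matter. *)
Definition order_equivalence (K K' : choiceType) (P : preposet K)
    (P' : preposet K') (chi : K -> K') : Prop :=
  [/\ (forall x, x \in carrier P -> chi x \in carrier P'),
      {in carrier P &, forall x y, ple P x y = ple P' (chi x) (chi y)} &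
      (forall y, y \in carrier P' ->
         exists2 x, x \in carrier P & peq P' (chi x) y)].

Definition skeleton_isomorphic (V : zmodType) (P1 P2 : preposet V) : Prop :=
  exists2 chi : V -> V,
    order_equivalence (skeleton P1) (skeleton P2) chi &
    forall a, a \in carrier (skeleton P1) -> peq P2 (chi (- a)) (- chi a).

Definition dom_at (R : realType) (n : nat) (Phi Pos : {fset 'cV[R]_n})
    (D : {fset 'M[R]_n}) (g : 'cV[R]_n) : {fset 'M[R]_n} :=
  [fset v in D | g \in inv_set Phi Pos v]%fset.

Definition phi_le (R : realType) (n : nat) (Phi Pos : {fset 'cV[R]_n})
    (D : {fset 'M[R]_n}) : rel 'cV[R]_n :=
  fun a b => (dom_at Phi Pos D b `<=` dom_at Phi Pos D a)%fset.

Lemma phi_refl (R : realType) (n : nat) (Phi Pos : {fset 'cV[R]_n})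
    (D : {fset 'M[R]_n}) : {in Phi, reflexive (phi_le Phi Pos D)}.
Proof. by move=> a _; exact: fsubset_refl. Qed.

Lemma phi_trans (R : realType) (n : nat) (Phi Pos : {fset 'cV[R]_n})
    (D : {fset 'M[R]_n}) : {in Phi & &, transitive (phi_le Phi Pos D)}.
Proof. by move=> b a c _ _ _ ab bc; exact: fsubset_trans bc ab. Qed.

Definition phi (R : realType) (n : nat) (Phi Pos : {fset 'cV[R]_n})
    (D : {fset 'M[R]_n}) : preposet 'cV[R]_n :=
  Preposet (@phi_refl R n Phi Pos D) (@phi_trans R n Phi Pos D).

(* Main.v *)
Require Import Defs.
From mathcomp Require Import all_boot all_order all_algebra finmap.
From mathcomp Require Import boolp classical_sets reals.
From mathcomp Require Import ring lra.
Set Implicit Arguments.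
Unset Strict Implicit.
Unset Printing Implicit Defensive.
Import Order.TTheory GRing.Theory Num.Theory.

(** The proof views a closed Condorcet domain D as a median graph whose
    halfspaces are the sets D(a) of the elements having a in their inversion
    set.

    The geometric input is a criterion for inversion sets
    ([inv_set_of_signs]): a set of roots that contains exactly one of a, - a
    for every root a, and no root-triple, is the inversion set of some element
    of the group.  If x, y, z vote once each in D, the set of roots held by a
    majority meets these conditions: for a root-triple in it, any two of the
    three roots would be held by a common voter, and these voters would be
    distinct because no inversion set contains a root-triple, contradicting
    the Condorcet property.  Closedness then puts the majority element in D,
    so D has medians ([halfspaces_median]).  Elements of D are moreover told
    apart by their inversion sets ([inv_set_inj]), that is, the group acts
    freely on the chambers.

    From the graph to the skeleton.  In a median structure let sep x y be the
    number of halfspaces containing x but not y.  Neighbors are separated by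
    exactly one halfspace, and any non-neighbors can be split by a third
    point, so sep is the graph distance and a graph isomorphism preserves it.
    The halfspace crossed by an edge u v is the set of points closer to u than
    to v ([adjacent_halfspaceE]), and every proper halfspace is crossed by an
    edge; so proper halfspaces correspond ([halfspace_image]).  As the classes
    of skeleton elements of phi(D) are exactly the proper halfspaces, ordered
    by reverse inclusion, this yields the skeleton isomorphism.

    From the skeleton to the graph.  Halfspaces of a median structure have the
    Helly property ([helly]), so a choice of one of a, - a for every skeleton
    root a comes from an element of D as soon as the chosen roots are pairwise
    compatible, and compatibility of a and b is expressed by the order of
    phi(D) as the failure of - b <= a ([skeleton_realize]).  Hence D can be
    rebuilt from the skeleton with its negation, and with D the neighbor
    relation. *)

(** * Median structures *)

(** For halfspaces cut out by roots this says that the inversion set of z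
    contains the common part of those of x and y. *)
Definition between (T : finType) (HS : {set {set T}}) (x z y : T) : bool :=
  [forall H in HS, (x \in H) && (y \in H) ==> (z \in H)].

Definition adjacent (T : finType) (HS : {set {set T}}) : rel T :=
  fun x y => (x != y) &&
    ~~ [exists z : T, [&& z != x, z != y & between HS x z y]].

(** Halfspaces of a finite median algebra: the point m is a median of x, y
    and z. *)
Definition median_structure (T : finType) (HS : {set {set T}}) : Prop :=
  [/\ {in HS, forall H, ~: H \in HS},
      (forall x y, (forall H, H \in HS -> (x \in H) = (y \in H)) -> x = y) &
      (forall x y z, exists m,
         [/\ between HS x m y, between HS x m z & between HS y m z])].

Definition sep (T : finType) (HS : {set {set T}}) (x y : T) : nat :=
  #|[set H in HS | (x \in H) && (y \notin H)]|.

Section MedianStructure.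
Variables (T : finType) (HS : {set {set T}}).
Hypothesis HSm : median_structure HS.
Implicit Types (x y z u v : T) (H K : {set T}).

Lemma betweenP x z y :
  reflect (forall H, H \in HS -> x \in H -> y \in H -> z \in H)
          (between HS x z y).
Proof.
apply: (iffP forall_inP) => h H HH; last first.
  by apply/implyP => /andP[]; exact: h.
by move=> xH yH; apply: (implyP (h H HH)); rewrite xH.
Qed.

Lemma adjacentC x y : adjacent HS x y = adjacent HS y x.
Proof.
have bC z : between HS x z y = between HS y z x.
  by apply/betweenP/betweenP => h H HH a b; exact: h.
rewrite /adjacent eq_sym; congr (_ && ~~ _).
by apply: eq_existsb => z; rewrite bC andbCA.
Qed.

Lemma sepxx x : sep HS x x = 0%N.
Proof. by apply: eq_card0 => H; rewrite !inE andbN andbF. Qed.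

Lemma sep_triangle x y z : sep HS x z <= sep HS x y + sep HS y z.
Proof.
rewrite /sep; apply: leq_trans (leq_card_setU _ _); apply: subset_leq_card.
apply/fintype.subsetP => H; rewrite !inE => /andP[-> /andP[-> ->]] /=.
by case: (y \in H).
Qed.

Lemma separated x y : x != y -> exists2 H, H \in HS & (x \in H) && (y \notin H).
Proof.
have [HC Hs _] := HSm => nxy.
have /existsP[H /andP[HH e]] : [exists H, (H \in HS) && ((x \in H) != (y \in H))].
  apply: contraR nxy => /existsPn h; apply/eqP/Hs => H HH.
  by have := h H; rewrite HH negbK => /eqP.
case xH: (x \in H) e => e; first by exists H => //; rewrite xH.
by exists (~: H); rewrite ?HC // !inE xH negbK; case: (y \in H) e.
Qed.

Lemma sep_gt0 x y : x != y -> 0 < sep HS x y.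
Proof. by case/separated=> H HH h; apply/card_gt0P; exists H; rewrite !inE HH. Qed.

Lemma sep_between x z y :
  between HS x z y -> sep HS x y = (sep HS x z + sep HS z y)%N.
Proof.
have [HC _ _] := HSm; move=> /betweenP b; rewrite /sep -cardsUI.
rewrite [X in _ = (_ + X)%N]eq_card0 ?addn0; last first.
  by move=> H; rewrite !inE; case: (z \in H); rewrite ?andbF.
apply: eq_card => H; rewrite !inE; case HH: (H \in HS) => //=.
have := b _ HH; have := b _ (HC _ HH); rewrite !inE.
case: (x \in H); case: (y \in H); case: (z \in H) => //=.
  by move=> _ /(_ isT isT).
by move=> /(_ isT isT).
Qed.

(** If t lay in H but not in K, the median of x, y and t would lie in H and
    outside K, hence strictly between x and y. *)
Lemma adjacent_unique x y H K :
    adjacent HS x y -> H \in HS -> K \in HS ->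
    x \in H -> y \notin H -> x \in K -> y \notin K ->
  H = K.
Proof.
have [HC _ Hm] := HSm.
move=> /andP[_ /existsPn nb] HH HK xH yH xK yK.
have aux A B : A \in HS -> B \in HS -> x \in A -> y \notin A -> x \in B -> y \notin B ->
    A \subset B.
  move=> HA HB xA yA xB yB; apply/fintype.subsetP => t tA; apply: contraT => tB.
  have [z [bxy bxt byt]] := Hm x y t.
  have zA : z \in A by exact: (betweenP _ _ _ bxt).
  have : z \in ~: B by apply: (betweenP _ _ _ byt); rewrite ?HC ?inE.
  rewrite inE => zB; have /negP[] := nb z; rewrite bxy andbT.
  by apply/andP; split; [apply: contraNneq zB | apply: contraNneq yA] => [-> | <-].
by apply/eqP; rewrite finset.eqEsubset !aux.
Qed.

Lemma sep_adjacent x y : adjacent HS x y -> sep HS x y = 1%N.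
Proof.
move=> xy; have /andP[nxy _] := xy; have [H HH /andP[xH yH]] := separated nxy.
rewrite /sep (_ : [set _ in _ | _] = [set H]) ?cards1 //.
apply/setP => K; rewrite !inE; apply/andP/eqP => [[KS /andP[xK yK]]|->].
  exact: (adjacent_unique xy).
by rewrite HH xH.
Qed.

(** Together with [sep_between] and [sep_adjacent], this makes sep the graph
    distance, in a form suited to induction on sep, without paths. *)
Lemma sep_split x y : x != y -> ~~ adjacent HS x y ->
  exists z, [/\ between HS x z y, sep HS x z < sep HS x y & sep HS z y < sep HS x y].
Proof.
move=> nxy; rewrite /adjacent nxy negbK /= => /existsP[z /and3P[zx zy b]].
exists z; split=> //; rewrite (sep_between b).
  by rewrite -addn1 leq_add2l sep_gt0.
by rewrite -add1n leq_add2r sep_gt0 // eq_sym.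
Qed.

(** The halfspaces separating x from u or from v are the same, except for H
    and its complement, the only ones crossed by the edge u v. *)
Lemma adjacent_halfspaceE u v H x :
    adjacent HS u v -> H \in HS -> u \in H -> v \notin H ->
  (x \in H) = (sep HS x u < sep HS x v).
Proof.
have [HC _ _] := HSm.
have aux a b A y : adjacent HS a b -> A \in HS -> a \in A -> b \notin A ->
    y \in A -> sep HS y a < sep HS y b.
  move=> ab HA aA bA yA; apply: proper_card; apply/properP; split; last first.
    by exists A; rewrite !inE HA yA ?bA // aA.
  apply/fintype.subsetP => K; rewrite !inE => /andP[KS /andP[yK aK]].
  rewrite KS yK /=; apply: contraL yA => bK.
  rewrite (@adjacent_unique a b A (~: K)) ?HC ?inE ?negbK ?aK ?bK //.
move=> uv HH uH vH; apply/idP/idP; first exact: (aux _ _ _ _ uv).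
apply: contraLR => xH; rewrite -leqNgt ltnW // (aux _ _ (~: H)) ?HC ?inE ?uH //.
by rewrite adjacentC.
Qed.

(** Shrink a pair of points separated by H until they are adjacent. *)
Lemma halfspace_edge H a b : H \in HS -> a \in H -> b \notin H ->
  exists u v, [/\ adjacent HS u v, u \in H & v \notin H].
Proof.
have [k] := ubnP (sep HS a b).
elim: k a b => // k IH a b ltk HH aH bH.
have [ab|nab] := boolP (adjacent HS a b); first by exists a, b.
have ne : a != b by apply: contraTneq aH => ->.
have [z [_ lt1 lt2]] := sep_split ne nab.
have [zH|zH] := boolP (z \in H); [apply: (IH z b) | apply: (IH a z)] => //.
  exact: leq_trans lt2 _.
exact: leq_trans lt1 _.
Qed.

(** For s = A, B, C, ..., take points lying in all members of s except
    possibly A, except possibly B, and except possibly C.  Every member of s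
    contains at least two of the three, hence their median. *)
Lemma helly (s : seq {set T}) : T -> {subset s <= HS} ->
    {in s &, forall H K, exists x, (x \in H) && (x \in K)} ->
  exists x, forall H, H \in s -> x \in H.
Proof.
move=> t0; have [_ _ Hm] := HSm.
have [k] := ubnP (size s); elim: k s => // k IH [|A [|B [|C s]]] ltk sS sI.
- by exists t0.
- have [||x /andP[xA _]] := sI A A; rewrite ?inE //.
  by exists x => K; rewrite !inE => /eqP->.
- have [||x /andP[xA xB]] := sI A B; rewrite ?inE ?eqxx ?orbT //.
  by exists x => K; rewrite !inE => /orP[] /eqP->.
have sub r : {subset r <= [:: A, B, C & s]} -> size r < k ->
    exists x, forall H, H \in r -> x \in H.
  by move=> rs rk; apply: IH => // [H /rs/sS //|H K /rs Hr /rs]; exact: sI.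
have [||x xP] := sub [:: B, C & s] => //.
  by move=> K; rewrite !inE => ->; rewrite orbT.
have [||y yP] := sub [:: A, C & s] => //.
  by move=> K; rewrite !inE => /or3P[]->; rewrite ?orbT.
have [||z zP] := sub [:: A, B & s] => //.
  by move=> K; rewrite !inE => /or3P[]->; rewrite ?orbT.
have [m [/betweenP xy /betweenP xz /betweenP yz]] := Hm x y z.
exists m => K KS; have HK := sS _ KS.
move: KS; rewrite !inE => /or4P[/eqP e|/eqP e|/eqP e|Ks].
- by apply: yz => //; [apply: yP | apply: zP]; rewrite e !inE eqxx.
- by apply: xz => //; [apply: xP | apply: zP]; rewrite e !inE eqxx ?orbT.
- by apply: xy => //; [apply: xP | apply: yP]; rewrite e !inE eqxx ?orbT.
- by apply: xy => //; [apply: xP | apply: yP]; rewrite !inE Ks !orbT.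
Qed.

End MedianStructure.

(** As sep is the graph distance, this only uses that the edges of a path are
    sent to edges. *)
Lemma sep_morph (T T' : finType) (HS : {set {set T}}) (HS' : {set {set T'}})
    (g : T -> T') :
    median_structure HS -> median_structure HS' ->
    (forall x y, adjacent HS x y -> adjacent HS' (g x) (g y)) ->
  forall x y, sep HS' (g x) (g y) <= sep HS x y.
Proof.
move=> HSm HSm' gP x y; have [k] := ubnP (sep HS x y).
elim: k x y => // k IH x y ltk.
have [->|ne] := eqVneq x y; first by rewrite sepxx.
have [xy|nxy] := boolP (adjacent HS x y).
  by rewrite (sep_adjacent HSm xy) (sep_adjacent HSm' (gP _ _ xy)).
have [z [b lt1 lt2]] := sep_split HSm ne nxy.
rewrite (sep_between HSm b); apply: leq_trans (sep_triangle _ _ (g z) _) _.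
by apply: leq_add; apply: IH; [exact: leq_trans lt1 _ | exact: leq_trans lt2 _].
Qed.

(** The image of H is again the set of points nearer to one end of an edge
    than to the other. *)
Lemma halfspace_image (T T' : finType) (HS : {set {set T}})
    (HS' : {set {set T'}}) (g : T -> T') (H : {set T}) :
    median_structure HS -> median_structure HS' -> bijective g ->
    (forall x y, adjacent HS' (g x) (g y) = adjacent HS x y) ->
    H \in HS -> H != finset.set0 -> ~: H != finset.set0 ->
  exists2 H', H' \in HS' & forall x, (g x \in H') = (x \in H).
Proof.
move=> HSm HSm' [f fK gK] gP HH /finset.set0Pn[a aH] /finset.set0Pn[b].
rewrite inE => bH.
have gsep x y : sep HS' (g x) (g y) = sep HS x y.
  apply/eqP; rewrite eqn_leq (sep_morph HSm HSm') => [|u v]; last by rewrite gP.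
  rewrite -{1}(fK x) -{1}(fK y) (sep_morph HSm' HSm) // => u v.
  by rewrite -gP !gK.
have [u [v [uv uH vH]]] := halfspace_edge HSm HH aH bH.
have uv' : adjacent HS' (g u) (g v) by rewrite gP.
have [H' HH' /andP[uH' vH']] := separated HSm' (proj1 (andP uv')).
exists H' => // x.
rewrite (adjacent_halfspaceE HSm' _ uv') // !gsep.
by rewrite -(adjacent_halfspaceE HSm x uv HH uH vH).
Qed.

Local Open Scope ring_scope.

(** * Reflections *)

Section Dot.
Variables (R : realType) (n : nat).
Implicit Types (u v x a b : 'cV[R]_n) (c : R).

Lemma dotC u v : dot u v = dot v u.
Proof. by apply: eq_bigr => i _; rewrite mulrC. Qed.

Lemma dotDr x u v : dot x (u + v) = dot x u + dot x v.
Proof. by rewrite -big_split; apply: eq_bigr => i _; rewrite mxE mulrDr. Qed.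

Lemma dotZr c x u : dot x (c *: u) = c * dot x u.
Proof. by rewrite mulr_sumr; apply: eq_bigr => i _; rewrite mxE mulrCA. Qed.

Lemma dotr0 x : dot x 0 = 0.
Proof. by rewrite -(scale0r 0) dotZr mul0r. Qed.

Lemma dotNr x u : dot x (- u) = - dot x u.
Proof. by rewrite -scaleN1r dotZr mulN1r. Qed.

Lemma dotBr x u v : dot x (u - v) = dot x u - dot x v.
Proof. by rewrite dotDr dotNr. Qed.

Lemma dotBl x u v : dot (u - v) x = dot u x - dot v x.
Proof. by rewrite dotC dotBr !(dotC x). Qed.

Lemma dotNl x u : dot (- u) x = - dot u x.
Proof. by rewrite dotC dotNr dotC. Qed.

Lemma dotZl c x u : dot (c *: u) x = c * dot u x.
Proof. by rewrite dotC dotZr dotC. Qed.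

Lemma dot_gt0 u : u != 0 -> 0 < dot u u.
Proof.
have ge0 (i : 'I_n) : true -> 0 <= u i 0 * u i 0 by rewrite -expr2 sqr_ge0.
move=> nz; rewrite lt_neqAle sumr_ge0 // andbT eq_sym.
apply: contraNneq nz => e; apply/eqP/colP => i; rewrite mxE.
by have /eqP := psumr_eq0P ge0 e (i := i) isT; rewrite mulf_eq0 orbb => /eqP.
Qed.

Lemma reflectionE a x :
  reflection a *m x = x - (2 * dot a x / dot a a) *: a.
Proof.
rewrite /reflection mulmxBl mul1mx -scalemxAl -mulmxA; congr (_ - _).
have -> : a^T *m x = (dot a x)%:M.
  apply/matrixP => i j; rewrite !ord1 !mxE eqxx mulr1n.
  by apply: eq_bigr => k _; rewrite mxE.
by rewrite mul_mx_scalar scalerA mulrAC.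
Qed.

Lemma mulmx_inj_col (A B : 'M[R]_n) :
  (forall x : 'cV[R]_n, A *m x = B *m x) -> A = B.
Proof.
move=> AB; apply/matrixP => i j.
have := AB (delta_mx j 0); rewrite -!colE => /colP/(_ i).
by rewrite !mxE.
Qed.

Lemma reflectionN a : reflection (- a) = reflection a.
Proof.
apply: mulmx_inj_col => x.
by rewrite !reflectionE !dotNl dotNr opprK mulrN mulNr scalerN scaleNr opprK.
Qed.

Section NonzeroRoot.
Variable a : 'cV[R]_n.
Hypothesis a0 : a != 0.

Lemma dotaa_neq0 : dot a a != 0. Proof. by rewrite gt_eqF ?dot_gt0. Qed.

Lemma reflection_root : reflection a *m a = - a.
Proof.
rewrite reflectionE mulfK ?dotaa_neq0 //.
by rewrite -[X in X - _]scale1r -scalerBl -scaleN1r; congr (_ *: _); ring.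
Qed.

Lemma dot_reflection x y :
  dot (reflection a *m x) (reflection a *m y) = dot x y.
Proof.
rewrite !reflectionE !dotBl !dotBr !dotZl !dotZr [dot x a]dotC.
by field; exact: dotaa_neq0.
Qed.

Lemma reflection_mulK x : reflection a *m (reflection a *m x) = x.
Proof.
rewrite [reflection a *m x]reflectionE mulmxBr -scalemxAr reflection_root.
by rewrite reflectionE scalerN opprK subrK.
Qed.

Lemma reflectionK : reflection a *m reflection a = 1%:M.
Proof.
by apply: mulmx_inj_col => x; rewrite -mulmxA reflection_mulK mul1mx.
Qed.

Lemma dot_reflectionC x y :
  dot (reflection a *m x) y = dot x (reflection a *m y).
Proof. by rewrite -{1}[y]reflection_mulK dot_reflection. Qed.

Lemma reflection_conj b :
  reflection (reflection a *m b) = reflection a *m reflection b *m reflection a.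
Proof.
apply: mulmx_inj_col => x; rewrite -!mulmxA.
rewrite reflectionE [reflection b *m _]reflectionE mulmxBr reflection_mulK.
by rewrite -scalemxAr dot_reflection dot_reflectionC.
Qed.

End NonzeroRoot.

Definition refl_prod (s : seq 'cV[R]_n) : 'M[R]_n :=
  \big[mulmx/1%:M]_(a <- s) reflection a.

Lemma refl_prod_nil : refl_prod [::] = 1%:M.
Proof. exact: big_nil. Qed.

Lemma refl_prod_cons a s : refl_prod (a :: s) = reflection a *m refl_prod s.
Proof. exact: big_cons. Qed.

Lemma refl_prod_cat s t : refl_prod (s ++ t) = refl_prod s *m refl_prod t.
Proof.
elim: s => [|a s IH] /=; first by rewrite refl_prod_nil mul1mx.
by rewrite !refl_prod_cons IH mulmxA.
Qed.

Lemma refl_prod1 a : refl_prod [:: a] = reflection a.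
Proof. by rewrite refl_prod_cons refl_prod_nil mulmx1. Qed.

Lemma refl_prod_rev s : 0 \notin s -> refl_prod (rev s) *m refl_prod s = 1%:M.
Proof.
elim: s => [|a s IH]; first by rewrite /= !refl_prod_nil mulmx1.
rewrite inE negb_or eq_sym => /andP[a0 s0].
rewrite rev_cons -cats1 refl_prod_cat refl_prod1 refl_prod_cons -mulmxA.
by rewrite (mulmxA (reflection a)) reflectionK // mul1mx IH.
Qed.

Lemma invmx_refl_prod s : 0 \notin s -> invmx (refl_prod s) = refl_prod (rev s).
Proof.
move=> /refl_prod_rev e; have [_ us] := mulmx1_unit e.
by rewrite -[LHS]mul1mx -e mulmxK.
Qed.

End Dot.

(** * Simple roots and the free action on chambers *)
Lemma real_measure_ind (R : realType) (T : finType) (q : T -> R) (P : T -> Prop) :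
  (forall x, (forall y, (q y < q x)%R -> P y) -> P x) -> forall x, P x.
Proof.
move=> H x; have [k] := ubnP #|[set y | q y < q x]|.
elim: k x => // k IH x ltk; apply: H => y yx; apply: IH.
rewrite -ltnS; apply: leq_trans ltk; rewrite ltnS.
apply: proper_card; apply/properP; split.
  by apply/fintype.subsetP => z; rewrite !inE => zy; exact: lt_trans yx.
by exists y; rewrite !inE ?ltxx.
Qed.

Section RootSystem.
Variables (R : realType) (n : nat) (Phi Pos : {fset 'cV[R]_n}).
Hypothesis HPhi : root_system Phi.
Hypothesis HPos : positive_system Phi Pos.
Implicit Types (a b c x : 'cV[R]_n) (s : seq 'cV[R]_n) (w : 'M[R]_n).

Lemma root_neq0 a : a \in Phi -> a != 0.
Proof. by have [P0 _ _] := HPhi; apply: contraTneq => ->. Qed.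

Lemma word_neq0 s : {subset s <= Phi} -> 0 \notin s.
Proof. by have [P0 _ _] := HPhi => sP; apply: contraNN P0 => /sP. Qed.

Lemma rootN a : (- a \in Phi) = (a \in Phi).
Proof.
have [_ PR _] := HPhi.
suff aux b : b \in Phi -> - b \in Phi by apply/idP/idP => /aux; rewrite ?opprK.
move=> bP; have : [set b; - b]%classic (- b) by right.
by rewrite -(PR _ bP) => -[].
Qed.

Lemma root_scale a (c : R) : a \in Phi -> c *: a \in Phi -> c *: a = a \/ c *: a = - a.
Proof.
have [_ PR _] := HPhi; move=> aP caP.
have : ([set` Phi] `&` range (fun c : R => c *: a))%classic (c *: a).
  by split=> //; exists c.
by rewrite PR.
Qed.

Lemma root_reflection a b : a \in Phi -> b \in Phi -> reflection a *m b \in Phi.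
Proof.
by have [_ _ PS] := HPhi; move=> aP bP; rewrite -[in X in _ \in X](PS a aP) in_imfset.
Qed.

Lemma root_word s b : {subset s <= Phi} -> b \in Phi -> refl_prod s *m b \in Phi.
Proof.
elim: s => [|a s IH] sP bP; first by rewrite refl_prod_nil mul1mx.
rewrite refl_prod_cons -mulmxA root_reflection ?(sP a) ?mem_head //.
by apply: IH => // c cs; rewrite sP // inE cs orbT.
Qed.

Lemma posW a : a \in Pos -> a \in Phi.
Proof. by have [l _ ->] := HPos; rewrite !inE => /andP[]. Qed.

Lemma posN a : a \in Phi -> (- a \in Pos) = (a \notin Pos).
Proof.
have [l l0 ->] := HPos; move=> aP; rewrite !inE rootN aP /= dotNr oppr_gt0.
by rewrite -leNgt le_eqVlt (negPf (l0 _ aP)).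
Qed.

Lemma pos_neqN a b : a \in Pos -> b \in Pos -> a != - b.
Proof. by move=> aP bP; apply: contraTneq aP => ->; rewrite posN ?bP ?posW. Qed.

Lemma pos_scale a (c : R) : a \in Pos -> c *: a \in Pos -> c *: a = a.
Proof.
move=> aP caP; have [//|e] := root_scale (posW aP) (posW caP).
by move: caP; rewrite e posN ?aP ?posW.
Qed.

Lemma in_inv_set s a : {subset s <= Phi} ->
  (a \in inv_set Phi Pos (refl_prod s)) =
  (a \in Phi) && (refl_prod (rev s) *m a \notin Pos).
Proof.
move=> sP; rewrite !inE invmx_refl_prod ?word_neq0 //=.
case aP: (a \in Phi) => //=; rewrite root_word ?andbT // => b.
by rewrite mem_rev; exact: sP.
Qed.

(** The usual description by indecomposability is replaced by the property of
    simple roots that the exchange argument uses. *)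
Definition simple_root a : bool :=
  (a \in Pos) && [forall b : Pos, (val b != a) ==> (reflection a *m val b \in Pos)].

Lemma simple_rootP a b :
  simple_root a -> b \in Pos -> b != a -> reflection a *m b \in Pos.
Proof. by move=> /andP[_ /forallP h] bP; apply: (implyP (h [` bP]%fset)). Qed.

Lemma simple_pos a : simple_root a -> a \in Pos.
Proof. by case/andP. Qed.

Lemma all_simple_sub s : all simple_root s -> {subset s <= Phi}.
Proof. by move=> /allP h a /h/simple_pos/posW. Qed.

(** Well-founded induction on the squared height of b after normalisation,
    (l, b)^2 / (b, b).  If a positive root b is not simple, s_b sends some
    positive c different from b to a negative root.  Let g be the lower of c
    and - s_b c, whose sum is a multiple of b.  By the strict Cauchy-Schwarz
    inequality both g and s_g b are lower than b after normalisation, and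
    s_b = s_g s_(s_g b) s_g. *)
Lemma simple_word a : a \in Phi ->
  exists2 s, all simple_root s & reflection a = refl_prod s.
Proof.
suff aux (b : Pos) : exists2 s, all simple_root s & reflection (val b) = refl_prod s.
  move=> aP; have [aPos|] := boolP (a \in Pos); first exact: (aux [` aPos]%fset).
  rewrite -posN // => NaPos; have [s] := aux [` NaPos]%fset.
  by rewrite /= reflectionN; exists s.
have [l l0 PosE] := HPos.
have lpos c : c \in Pos -> 0 < dot l c by rewrite PosE !inE => /andP[].
pose q (b : Pos) := dot l (val b) ^+ 2 / dot (val b) (val b).
elim/(real_measure_ind (q := q)): b => -[b bP] IH; rewrite /q /= in IH *.
have {}IH c : c \in Phi -> dot l c ^+ 2 / dot c c < dot l b ^+ 2 / dot b b ->
    exists2 s, all simple_root s & reflection c = refl_prod s.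
  move=> cP lt; have [cPos|] := boolP (c \in Pos); first exact: (IH [` cPos]%fset).
  rewrite -posN // => NcPos; have [|s] := IH [` NcPos]%fset.
    by rewrite /= dotNr dotNl dotNr opprK sqrrN.
  by rewrite /= reflectionN; exists s.
have bPhi := posW bP; have b0 := root_neq0 bPhi; have lb := lpos _ bP.
have [sb|] := boolP (simple_root b).
  by exists [:: b]; rewrite /= ?sb // refl_prod1.
rewrite /simple_root bP /= => /forallPn[[c cP]]; rewrite negb_imply /= => /andP[cb sc].
(* c and - s_b c have equal norms and add up to a multiple of b; g is the
   one of smaller height. *)
have [g [gP gb lg]] : exists g,
    [/\ g \in Pos, g != b & dot l g * dot b b <= dot b g * dot l b].
  have scP : - (reflection b *m c) \in Pos by rewrite posN ?root_reflection ?posW.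
  have bb := dot_gt0 b0.
  have [le|/ltW le] := leP (dot l c) (dot l (- (reflection b *m c))).
    exists c; split=> //; rewrite -ler_pdivlMr // mulrAC.
    move: le; rewrite dotNr reflectionE dotBr dotZr; lra.
  exists (- (reflection b *m c)); split=> //.
    apply: contraNneq cb => e.
    rewrite -[c](reflection_mulK b0) -[reflection b *m c]opprK e.
    by rewrite mulmxN reflection_root // opprK.
  rewrite [X in _ <= X * _]dotNr -dot_reflectionC // reflection_root // dotNl opprK.
  rewrite -ler_pdivlMr // mulrAC.
  move: le; rewrite dotNr reflectionE dotBr dotZr; lra.
have gPhi := posW gP; have g0 := root_neq0 gPhi; have lg0 := lpos _ gP.
have gg := dot_gt0 g0; have bb := dot_gt0 b0.
have cs : dot b g ^+ 2 < dot b b * dot g g.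
  have nz : dot b b *: g - dot b g *: b != 0.
    apply: contraNneq gb => /eqP; rewrite subr_eq0 => /eqP e.
    have e' : (dot b g / dot b b) *: b = g.
      by rewrite mulrC -scalerA -e scalerA mulVf ?scale1r ?gt_eqF.
    by rewrite -e' (pos_scale bP) // e'.
  have := dot_gt0 nz; rewrite !dotBl !dotBr !dotZl !dotZr [dot g b]dotC.
  have -> : dot b b * (dot b b * dot g g) - dot b b * (dot b g * dot b g) -
     (dot b g * (dot b b * dot b g) - dot b g * (dot b g * dot b b)) =
     dot b b * (dot b b * dot g g - dot b g ^+ 2) by ring.
  by rewrite pmulr_rgt0 // subr_gt0.
set A := dot b b in bb lg cs IH *; set G := dot g g in gg cs *.
set B := dot b g in lg cs *; set p := dot l b in lg lb IH *; set r := dot l g in lg lg0 *.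
have BG : 0 < B by have := mulr_gt0 lg0 bb; nra.
have [||s sS se] := IH g => //.
  rewrite -/r -/G ltr_pdivrMr // mulrAC ltr_pdivlMr //.
  have h1 : (r * A) ^+ 2 <= (B * p) ^+ 2.
    by rewrite ler_sqr ?nnegrE // ltW // mulr_gt0.
  have h2 : (B * p) ^+ 2 < p ^+ 2 * G * A.
    rewrite exprMn [ltRHS](_ : _ = A * G * p ^+ 2); last by ring.
    by rewrite ltr_pM2r // exprn_gt0.
  have := le_lt_trans h1 h2.
  rewrite (_ : (r * A) ^+ 2 = r ^+ 2 * A * A); last by ring.
  by rewrite ltr_pM2r.
have [||t tS te] := IH (reflection g *m b); first exact: root_reflection.
  rewrite dot_reflection // -/A ltr_pM2r ?invr_gt0 //.
  rewrite reflectionE dotBr dotZr -/p -/r [dot g b]dotC -/B -/G.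
  set k := 2 * B / G * r.
  have k0 : 0 < k by rewrite !mulr_gt0 ?invr_gt0.
  have k2 : k < 2 * p.
    rewrite /k mulrAC ltr_pdivrMr //.
    rewrite -(ltr_pM2r bb).
    have : B * (r * A) <= B * (B * p) by rewrite ler_pM2l.
    have : B ^+ 2 * p < A * G * p by rewrite ltr_pM2r.
    lra.
  by rewrite -subr_gt0 (_ : _ - _ = k * (2 * p - k)); [rewrite mulr_gt0 ?subr_gt0 | ring].
exists (s ++ t ++ s); first by rewrite !all_cat sS tS.
rewrite !refl_prod_cat -se -te reflection_conj // !mulmxA reflectionK // mul1mx.
by rewrite -!mulmxA reflectionK // mulmx1.
Qed.

(** Reading the word s from the left, b is moved through positive roots until
    it equals the next letter, which is then cancelled: a simple reflection
    makes no other positive root negative. *)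
Lemma exchange s b : all simple_root s -> b \in Pos ->
    refl_prod (rev s) *m b \notin Pos ->
  exists s', [/\ all simple_root s', size s = (size s').+1 &
                 reflection b *m refl_prod s = refl_prod s'].
Proof.
elim: s b => [|d s IH] b; first by move=> _ bP; rewrite /= refl_prod_nil mul1mx bP.
move=> /= /andP[dS sS] bP; have d0 := root_neq0 (posW (simple_pos dS)).
rewrite rev_cons -cats1 refl_prod_cat refl_prod1 -mulmxA => nP.
have [->|bd] := eqVneq b d.
  by exists s; rewrite refl_prod_cons mulmxA reflectionK // mul1mx.
have [s' [s'S sz e]] := IH _ sS (simple_rootP dS bP bd) nP.
exists (d :: s'); rewrite /= dS s'S sz; split=> //.
by rewrite !refl_prod_cons -e reflection_conj // !mulmxA reflectionK // mul1mx.
Qed.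

(** Freeness.  Rewrite the product as a word d :: t in simple reflections.  Its
    inverse keeps d positive, so the inverse of the product of t sends d to a
    negative root, and [exchange] shortens the word. *)
Lemma word_fix_pos s : {subset s <= Phi} ->
  (forall b, b \in Pos -> refl_prod s *m b \in Pos) -> refl_prod s = 1%:M.
Proof.
move=> sP; have [t tS ->] : exists2 t, all simple_root t & refl_prod s = refl_prod t.
  elim: s sP => [|a s IH] sP; first by exists [::].
  have [|t tS te] := IH; first by move=> c cs; rewrite sP // inE cs orbT.
  have [|u uS ue] := @simple_word a; first by rewrite sP ?mem_head.
  by exists (u ++ t); rewrite ?all_cat ?uS // refl_prod_cat refl_prod_cons ue te.
have [k] := ubnP (size t); elim: k t tS => // k IH [|d t] tS szt h.
  exact: refl_prod_nil.
have dtP := all_simple_sub tS.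
move: tS => /= /andP[dS tS]; have dP := simple_pos dS; have dPhi := posW dP.
have dtd : refl_prod (rev (d :: t)) *m d \in Pos.
  have rP : {subset rev (d :: t) <= Phi} by move=> c; rewrite mem_rev; exact: dtP.
  have pP := root_word rP dPhi.
  apply: contraT; rewrite -posN // => /h.
  by rewrite mulmxN mulmxA -{1}[d :: t]revK refl_prod_rev ?mul1mx ?posN ?dP // word_neq0.
have [|t' [t'S sz e]] := exchange tS dP.
  move: dtd; rewrite rev_cons -cats1 refl_prod_cat refl_prod1 -mulmxA.
  rewrite reflection_root ?root_neq0 // mulmxN posN // root_word // => c.
  by rewrite mem_rev => ct; rewrite dtP // inE ct orbT.
rewrite refl_prod_cons e in h *; apply: IH => //.
by move: szt; rewrite /= sz !ltnS => /ltnW.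
Qed.

Lemma inv_set_inj : {in coxeter_group Phi &, injective (inv_set Phi Pos)}.
Proof.
move=> u v; rewrite !inE => -[s sP ->] [t tP ->] /fsetP e.
rewrite -!/(refl_prod _) in e *.
have rP r : {subset r <= Phi} -> {subset rev r <= Phi}.
  by move=> rP c; rewrite mem_rev; exact: rP.
have h : refl_prod (rev s ++ t) = 1%:M.
  apply: word_fix_pos => [c|b bP]; first by rewrite mem_cat => /orP[/(rP _ sP)|/tP].
  have := e (refl_prod t *m b).
  rewrite !in_inv_set // root_word ?posW //= (mulmxA (refl_prod (rev t))).
  rewrite refl_prod_rev ?word_neq0 //.
  by rewrite mul1mx bP refl_prod_cat -mulmxA => /negbFE.
have := refl_prod_rev (word_neq0 (rP _ sP)); rewrite revK => ss.
by rewrite -[RHS]mul1mx -ss -mulmxA -refl_prod_cat h mulmx1.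
Qed.

Lemma inv_setN s a : {subset s <= Phi} -> a \in Phi ->
  (- a \in inv_set Phi Pos (refl_prod s)) = (a \notin inv_set Phi Pos (refl_prod s)).
Proof.
move=> sP aP; rewrite !in_inv_set // rootN aP /= mulmxN posN //.
by rewrite root_word // => c; rewrite mem_rev; exact: sP.
Qed.

(** * Inversion sets among sets of roots *)

(** The three roots are sent to one open side of a hyperplane. *)
Lemma inv_set_no_triple s a b c : {subset s <= Phi} -> root_triple Phi a b c ->
  a \in inv_set Phi Pos (refl_prod s) -> b \in inv_set Phi Pos (refl_prod s) ->
  c \notin inv_set Phi Pos (refl_prod s).
Proof.
move=> sP [[aP bP cP] [_ [x [y [z [[x0 y0 z0] e]]]]]].
have [l l0 PosE] := HPos.
have rP : {subset rev s <= Phi} by move=> d; rewrite mem_rev; exact: sP.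
have neg d : d \in inv_set Phi Pos (refl_prod s) -> dot l (refl_prod (rev s) *m d) < 0.
  rewrite in_inv_set // => /andP[dP]; have dP' := root_word rP dP.
  by rewrite PosE !inE dP' /= -leNgt le_eqVlt (negPf (l0 _ dP')).
move=> /neg ha /neg hb; apply/negP => /neg hc.
have := congr1 (fun d => dot l (refl_prod (rev s) *m d)) e.
rewrite /= !mulmxDr -!scalemxAr mulmx0 !dotDr !dotZr dotr0.
move: ha hb hc; rewrite -(pmulr_rlt0 _ x0) => ha; rewrite -(pmulr_rlt0 _ y0) => hb.
rewrite -(pmulr_rlt0 _ z0) => hc /eqP.
by apply/negP; rewrite lt_eqF // !ltr_nDl // ltW.
Qed.

Lemma reflected_triple a b c d : a \in Phi -> root_triple Phi b c d ->
  root_triple Phi (reflection a *m b) (reflection a *m c) (reflection a *m d).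
Proof.
move=> aP [[bP cP dP] [[bc bd cd] [x [y [z [h e]]]]]].
have inj := can_inj (reflection_mulK (root_neq0 aP)).
rewrite /root_triple !root_reflection // !(inj_eq inj); do 2!split=> //.
by exists x, y, z; split=> //; rewrite !scalemxAr -!mulmxDr e mulmx0.
Qed.

(** Induction on the number of positive roots in A.  If A has none, it is the
    inversion set of 1.  Otherwise take any positive a in A, simple or not,
    and apply the induction hypothesis to s_a A. *)
Lemma inv_set_of_signs (A : pred 'cV[R]_n) :
    {in Phi, forall a, A (- a) = ~~ A a} ->
    (forall a b c, root_triple Phi a b c -> A a -> A b -> ~~ A c) ->
  exists2 s, {subset s <= Phi} &
    {in Phi, forall a, (a \in inv_set Phi Pos (refl_prod s)) = A a}.
Proof.
have [k] := ubnP #|` [fset a in Pos | A a]%fset|.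
elim: k A => // k IH A ltk AN AT.
have [e|[a]] := fset_0Vmem [fset a in Pos | A a]%fset.
  exists [::] => // a aP; rewrite in_inv_set // aP /= refl_prod_nil mul1mx.
  have nA b : b \in Pos -> A b = false.
    by move=> bP; apply/negP => Ab; have := in_fset0 b; rewrite -e !inE bP Ab.
  have [/nA->//|] := boolP (a \in Pos); rewrite -posN // => /nA.
  by rewrite AN // => /negbFE->.
rewrite !inE => /andP[aPos Aa]; have aP := posW aPos; have a0 := root_neq0 aP.
pose A' b := A (reflection a *m b).
have [|||s sP sE] := IH A'.
- apply: leq_trans (_ : #|` [fset b in Pos | A b]%fset| <= _)%N => //.
  (* f injects the positive roots of s_a A into those of A other than a. *)
  pose f b := if reflection a *m b \in Pos then reflection a *m b else b.
  rewrite (cardfsD1 a [fset b in Pos | A b]%fset) !inE aPos Aa add1n ltnS.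
  have finj : {in [fset b in Pos | A' b]%fset &, injective f}.
    move=> b c; rewrite !inE => /andP[bPos _] /andP[cPos _]; rewrite /f.
    case: ifPn => [sb|sb]; case: ifPn => [sc|sc] e //.
    - by rewrite -[b](reflection_mulK a0) e reflection_mulK.
    - by move: sc; rewrite -e reflection_mulK // bPos.
    - by move: sb; rewrite e reflection_mulK // cPos.
  have /= <- := card_in_imfset imfset_key finj.
  apply: fsubset_leq_card; apply/fsubsetP => _ /imfsetP[b /= + ->].
    rewrite !inE => /andP[bPos A'b]; have bP := posW bPos.
    rewrite /f; case: ifPn => [sbP|sbN].
      rewrite sbP [A _]A'b !andbT.
      apply: contraNneq (pos_neqN bPos aPos) => e.
      by rewrite -[b](reflection_mulK a0) e reflection_root.
    have ba : b != a.
      by apply: contraTneq A'b => ->; rewrite /A' reflection_root // AN ?Aa.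
    rewrite ba bPos /=; apply: contraT => nAb.
    have sbP := root_reflection aP bP.
    (* If b were not in A, then s_a b, - b and a would be a root-triple in A:
       s_a b - b + c a = 0 for a coefficient c, positive as s_a b < 0. *)
    have [] := negP (AT (reflection a *m b) (- b) a _ A'b _); rewrite ?AN //.
    do 2!split; rewrite ?rootN //.
      split; last by rewrite eq_sym pos_neqN.
        apply: contraNneq ba => /eqP; rewrite reflectionE.
        rewrite -subr_eq0 opprK addrAC subr_eq0 -mulr2n -scaler_nat => /eqP e.
        have e' : (2^-1 * (2 * dot a b / dot a a)) *: a = b.
          by rewrite -scalerA -e scalerA mulVf ?scale1r ?pnatr_eq0.
        by rewrite -e' (pos_scale aPos) // e'.
      by apply: contraNneq sbN => ->.
    have [l l0 PosE] := HPos.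
    exists 1, 1, (2 * dot a b / dot a a); split; last first.
      by rewrite !scale1r reflectionE addrAC subrK subrr.
    split=> //; move: aPos bPos sbN; rewrite PosE !inE sbP aP bP /= -leNgt.
    rewrite reflectionE dotBr dotZr => la lb h.
    rewrite -(pmulr_lgt0 _ la); apply: lt_le_trans lb _.
    by rewrite -subr_le0.
- by move=> b bP; rewrite /A' mulmxN AN // root_reflection.
- by move=> b c d t; apply: AT; exact: reflected_triple.
exists (a :: s) => [b|b bP]; first by rewrite inE => /predU1P[->|/sP].
rewrite in_inv_set; last by move=> c; rewrite inE => /predU1P[->|/sP].
rewrite bP /= rev_cons -cats1 refl_prod_cat refl_prod1 -mulmxA.
have := sE (reflection a *m b) (root_reflection aP bP).
by rewrite in_inv_set // root_reflection //= /A' reflection_mulK.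
Qed.

End RootSystem.

(** * The median structure of a closed Condorcet domain *)

Section ClosedDomain.
Variables (R : realType) (n : nat) (Phi Pos : {fset 'cV[R]_n}).
Hypothesis HPhi : root_system Phi.
Hypothesis HPos : positive_system Phi Pos.
Variable D : {fset 'M[R]_n}.
Hypothesis HD : closed_condorcet_domain Phi Pos D.
Implicit Types (a b c : 'cV[R]_n) (u v w x y z : D).

Definition halfspace a : {set D} := [set v : D | a \in inv_set Phi Pos (val v)].

Definition halfspaces : {set {set D}} :=
  [set H | [exists a : Phi, H == halfspace (val a)]].

Lemma mem_halfspace a v : (v \in halfspace a) = (a \in inv_set Phi Pos (val v)).
Proof. by rewrite inE. Qed.

Lemma halfspacesP H :
  reflect (exists2 a, a \in Phi & H = halfspace a) (H \in halfspaces).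
Proof.
rewrite inE; apply: (iffP existsP) => [[a /eqP->]|[a aP ->]].
  by exists (val a); rewrite ?fsvalP.
by exists [` aP]%fset.
Qed.

Lemma halfspace_in a : a \in Phi -> halfspace a \in halfspaces.
Proof. by move=> aP; apply/halfspacesP; exists a. Qed.

Lemma dom_word v : exists2 s, {subset s <= Phi} & val v = refl_prod s.
Proof. by have [[_ DW _] _] := HD; have := DW _ (fsvalP v). Qed.

Lemma halfspaceN a : a \in Phi -> halfspace (- a) = ~: halfspace a.
Proof.
move=> aP; apply/setP => v; rewrite finset.in_setC !mem_halfspace.
by have [s sP ->] := dom_word v; rewrite (inv_setN HPhi HPos).
Qed.

Lemma halfspace_separates v w :
  (forall a, a \in Phi -> (v \in halfspace a) = (w \in halfspace a)) -> v = w.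
Proof.
have [[_ DW _] _] := HD; move=> e; apply: val_inj.
apply: (inv_set_inj HPhi HPos); rewrite ?inE.
- exact: DW (fsvalP v).
- exact: DW (fsvalP w).
apply/fsetP => a; have [aP|aP] := boolP (a \in Phi).
  by have := e a aP; rewrite !mem_halfspace.
by rewrite !inE (negPf aP).
Qed.

(** The voters x, y and z may coincide; the total is 3 in all cases, so that
    there is no tie. *)
Definition three_votes x y z : D -> nat :=
  fun v => ((v == x) + (v == y) + (v == z))%N.

Lemma votes_three x y z a : votes Phi Pos (three_votes x y z) a =
  ((x \in halfspace a) + (y \in halfspace a) + (z \in halfspace a))%N.
Proof.
rewrite /votes /three_votes !big_split /=.
have one w :
    (\sum_(v : D | a \in inv_set Phi Pos (val v)) (v == w) = (w \in halfspace a))%N.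
  rewrite big_mkcond (bigD1 w) //= eqxx big1 ?addn0 ?mem_halfspace //.
  by move=> v /negPf->; case: ifP.
by rewrite (one x) (one y) (one z).
Qed.

Lemma total_three x y z : total_votes (three_votes x y z) = 3.
Proof.
rewrite /total_votes /three_votes !big_split /=.
have one w : (\sum_(v : D) (v == w) = 1)%N.
  by rewrite (bigD1 w) //= eqxx big1 ?addn0 // => v /negPf->.
by rewrite (one x) (one y) (one z).
Qed.

(** The majority set of one vote each for x, y and z contains no root-triple,
    so it is the inversion set of a group element, which closedness puts in
    D. *)
Lemma domain_median x y z : exists m, forall a, a \in Phi ->
  (m \in halfspace a) =
  (1 < (x \in halfspace a) + (y \in halfspace a) + (z \in halfspace a))%N.
Proof.
have [[_ DW Dc] Dnu] := HD.
pose f := three_votes x y z; pose A a := (1 < votes Phi Pos f a)%N.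
have majE (t : nat) : ((3%:R / 2 : R) <= t%:R) = (1 < t)%N.
  by rewrite ler_pdivrMr // -natrM ler_nat; case: t => [|[|t]] //; rewrite !mulSn.
have AN : {in Phi, forall a, A (- a) = ~~ A a}.
  move=> a aP; rewrite /A !votes_three halfspaceN // !finset.in_setC.
  by case: (x \in _); case: (y \in _); case: (z \in _).
have AT a b c : root_triple Phi a b c -> A a -> A b -> ~~ A c.
  rewrite /A !votes_three => abc; rewrite -leqNgt => aM bM.
  have [[aP bP cP] _] := abc.
  rewrite leqNgt; apply/negP => cM; apply: Dc.
  have pair d e :
      (1 < (x \in halfspace d) + (y \in halfspace d) + (z \in halfspace d))%N ->
      (1 < (x \in halfspace e) + (y \in halfspace e) + (z \in halfspace e))%N ->
      exists v, (v \in halfspace d) && (v \in halfspace e).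
    case xd: (x \in halfspace d); case xe: (x \in halfspace e);
      first (by exists x; rewrite xd xe);
    case yd: (y \in halfspace d); case ye: (y \in halfspace e);
      first [by exists y; rewrite yd ye | idtac];
    case zd: (z \in halfspace d); case ze: (z \in halfspace e);
      first [by exists z; rewrite zd ze | by []].
  have ntr v : ~ [&& v \in halfspace a, v \in halfspace b & v \in halfspace c].
    rewrite !mem_halfspace; have [s sP ->] := dom_word v.
    by move=> /and3P[va vb]; apply/negP; exact: (inv_set_no_triple HPhi HPos sP abc).
  have [u /andP[ua ub]] := pair _ _ aM bM.
  have [v /andP[va vc]] := pair _ _ aM cM.
  have [w /andP[wb wc]] := pair _ _ bM cM.
  exists (val u), (val v), (val w), a, b, c.
  rewrite -!mem_halfspace !(inj_eq val_inj) !fsvalP; do !split=> //.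
  - by apply: contra_notN (ntr u) => /eqP e; rewrite ua ub e.
  - by apply: contra_notN (ntr u) => /eqP e; rewrite ua ub e.
  - by apply: contra_notN (ntr v) => /eqP e; rewrite va vc e wb.
have [s sP sE] := inv_set_of_signs HPhi HPos AN AT.
have mD : refl_prod s \in D.
  have : nu Phi Pos D (refl_prod s).
    exists f.
      split; first by exists x; rewrite /f /three_votes eqxx.
      move=> a aP; rewrite total_three => /(congr1 (fun r : R => r * 2)).
      rewrite divfK ?pnatr_eq0 // -natrM => /eqP; rewrite eqr_nat => /eqP /(congr1 odd).
      by rewrite oddM andbF.
    split; first by exists s.
    apply/fsubsetP => a aI; have aP : a \in Phi by move: aI; rewrite !inE => /andP[].
    rewrite !inE aP /= total_three majE; exact: etrans (esym (sE a aP)) aI.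
  by rewrite Dnu.
by exists [` mD]%fset => a aP; rewrite inE [LHS]sE // /A votes_three.
Qed.

Lemma halfspaces_median : median_structure halfspaces.
Proof.
split.
- by move=> _ /halfspacesP[a aP ->]; rewrite -halfspaceN // halfspace_in ?(rootN HPhi).
- by move=> v w e; apply: halfspace_separates => a aP; apply/e/halfspace_in.
move=> x y z; have [m mE] := domain_median x y z; exists m.
split; apply/betweenP => _ /halfspacesP[a aP ->]; rewrite mE // => -> -> //.
  by case: (y \in _).
by case: (x \in _).
Qed.

Lemma neighborsE v w : neighbors Phi Pos v w = adjacent halfspaces v w.
Proof.
rewrite /neighbors /adjacent; congr (_ && ~~ _).
apply: eq_existsb => u; do 2!congr (_ && _).
apply/fsubsetP/betweenP => [h _ /halfspacesP[a aP ->]|h a].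
  by rewrite !mem_halfspace => va wa; apply: h; rewrite in_fsetI va.
rewrite in_fsetI -!mem_halfspace => /andP[va wa].
have aP : a \in Phi by move: va; rewrite !inE => /andP[].
by apply: h va wa; exact: halfspace_in.
Qed.

Lemma mem_dom_at (m : 'M[R]_n) a :
  (m \in dom_at Phi Pos D a) = (m \in D) && (a \in inv_set Phi Pos m).
Proof. by rewrite /dom_at !inE. Qed.

Lemma phi_leE a b : phi_le Phi Pos D a b = (halfspace b \subset halfspace a).
Proof.
apply/fsubsetP/fintype.subsetP => h v.
  by move: (h (val v)); rewrite !mem_dom_at !mem_halfspace fsvalP.
rewrite !mem_dom_at => /andP[vD vb]; rewrite vD /=.
by have := h [` vD]%fset; rewrite !mem_halfspace /=; exact.
Qed.

Lemma peqE a b : peq (phi Phi Pos D) a b = (halfspace a == halfspace b).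
Proof. by rewrite /peq /= !phi_leE finset.eqEsubset andbC. Qed.

Lemma peq_skeletonE a b :
  peq (skeleton (phi Phi Pos D)) a b = (halfspace a == halfspace b).
Proof. exact: peqE. Qed.

(** A minimum a of phi(D) satisfies a <= - a, that is, D(a) contains its own
    complement; dually for maxima. *)
Lemma mem_skeleton a : (a \in carrier (skeleton (phi Phi Pos D))) =
  [&& a \in Phi, halfspace a != finset.set0 & ~: halfspace a != finset.set0].
Proof.
rewrite /= !inE /=; case aP: (a \in Phi); rewrite ?andbF //= andbT negb_or andbC.
congr (_ && _); congr (~~ _); apply/forallP/eqP => h.
- have := h [` aP]%fset; have := h [` (etrans (rootN HPhi a) aP)]%fset.
  rewrite /= !phi_leE halfspaceN // => h1 _.
  apply/setP => v; rewrite finset.in_set0; apply/negP => va.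
  by have := fintype.subsetP h1 v; rewrite finset.in_setC va => /(_ isT).
- by move=> b; rewrite phi_leE h finset.sub0set.
- have := h [` (etrans (rootN HPhi a) aP)]%fset.
  rewrite /= !phi_leE halfspaceN // => h1.
  apply/setP => v; rewrite finset.in_setC finset.in_set0; apply/negbTE; rewrite negbK.
  apply: contraT => va.
  by have := fintype.subsetP h1 v; rewrite finset.in_setC va (negPf va) => /(_ isT).
- by move=> b; rewrite phi_leE -[halfspace a]finset.setCK h finset.setC0 finset.subsetT.
Qed.

Lemma skeletonW a : a \in carrier (skeleton (phi Phi Pos D)) -> a \in Phi.
Proof. by rewrite mem_skeleton => /andP[]. Qed.

Lemma skeletonN a : (- a \in carrier (skeleton (phi Phi Pos D))) =
  (a \in carrier (skeleton (phi Phi Pos D))).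
Proof.
rewrite !mem_skeleton (rootN HPhi); case aP: (a \in Phi) => //=.
by rewrite halfspaceN // finset.setCK andbC.
Qed.

Lemma skeleton_determines v w :
  (forall a, a \in carrier (skeleton (phi Phi Pos D)) ->
     (v \in halfspace a) = (w \in halfspace a)) -> v = w.
Proof.
move=> e; apply: halfspace_separates => a aP.
have [aS|] := boolP (a \in carrier (skeleton (phi Phi Pos D))); first exact: e.
rewrite mem_skeleton aP /= negb_and !negbK => /orP[] /eqP h.
  by rewrite h !finset.in_set0.
by rewrite -[halfspace a]finset.setCK h !finset.in_setC !finset.in_set0.
Qed.

(** The chosen roots a and b are incompatible when D(a) and D(b) are disjoint,
    that is, when D(a) is contained in D(- b). *)
Lemma skeleton_realize (S : pred 'cV[R]_n) :
    (forall a, a \in carrier (skeleton (phi Phi Pos D)) -> S (- a) = ~~ S a) ->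
    (forall a b, a \in carrier (skeleton (phi Phi Pos D)) ->
       b \in carrier (skeleton (phi Phi Pos D)) -> S a -> S b ->
       ~~ phi_le Phi Pos D (- b) a) ->
  exists v, forall a, a \in carrier (skeleton (phi Phi Pos D)) ->
    (v \in halfspace a) = S a.
Proof.
move=> SN Sc; have [[/fset0Pn[d dD] _ _] _] := HD.
set sk := carrier _ in SN Sc *.
pose s := [seq halfspace a | a <- enum_fset sk & S a].
have sP H : reflect (exists a, [/\ a \in sk, S a & H = halfspace a]) (H \in s).
  apply: (iffP mapP) => [[a]|[a [aS Sa ->]]].
    by rewrite mem_filter => /andP[Sa aS] ->; exists a.
  by exists a; rewrite // mem_filter Sa.
have [||v vP] := helly halfspaces_median (s := s) [` dD]%fset.
- by move=> H /sP[a [aS _ ->]]; rewrite halfspace_in // skeletonW.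
- move=> _ _ /sP[a [aS Sa ->]] /sP[b [bS Sb ->]].
  have := Sc a b aS bS Sa Sb; rewrite phi_leE halfspaceN ?skeletonW //.
  case/fintype.subsetPn => x xa; rewrite finset.in_setC negbK => xb.
  by exists x; rewrite xa.
have vS a : a \in sk -> S a -> v \in halfspace a.
  by move=> aS Sa; apply: vP; apply/sP; exists a.
exists v => a aS; case Sa: (S a); first exact: vS.
apply/negbTE; have := vS (- a); rewrite /sk skeletonN => /(_ aS).
by rewrite SN // Sa halfspaceN ?skeletonW // finset.in_setC; exact.
Qed.

Lemma between_skeletonP v w z :
  reflect (forall a, a \in carrier (skeleton (phi Phi Pos D)) ->
             v \in halfspace a -> w \in halfspace a -> z \in halfspace a)
          (between halfspaces v z w).
Proof.
apply: (iffP (betweenP _ _ _ _)) => [h a aS|h _ /halfspacesP[a aP ->] va wa].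
  exact/h/halfspace_in/skeletonW.
have [aS|] := boolP (a \in carrier (skeleton (phi Phi Pos D))); first exact: h.
rewrite mem_skeleton aP /= negb_and !negbK => /orP[] /eqP e.
  by move: va; rewrite e finset.in_set0.
by rewrite -[halfspace a]finset.setCK e finset.in_setC finset.in_set0.
Qed.

End ClosedDomain.

(** * Graph isomorphisms and skeleton isomorphisms *)

Lemma skeleton_transport (R : realType) (n : nat) (Phi Pos : {fset 'cV[R]_n})
    (D D' : {fset 'M[R]_n}) (g : D -> D') :
    root_system Phi -> positive_system Phi Pos ->
    closed_condorcet_domain Phi Pos D -> closed_condorcet_domain Phi Pos D' ->
    bijective g ->
    (forall x y, neighbors Phi Pos (g x) (g y) = neighbors Phi Pos x y) ->
  forall a, a \in carrier (skeleton (phi Phi Pos D)) ->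
  exists2 a', a' \in carrier (skeleton (phi Phi Pos D')) &
    forall x, (g x \in halfspace Phi Pos D' a') = (x \in halfspace Phi Pos D a).
Proof.
move=> HPhi HPos HD HD' gbij gP a.
rewrite (mem_skeleton HPhi HPos HD) => /and3P[aP a0 aT].
have [|H' /halfspacesP[a' a'P ->] a'E] := halfspace_image
    (halfspaces_median HPhi HPos HD) (halfspaces_median HPhi HPos HD')
    gbij _ (halfspace_in Pos D aP) a0 aT.
  by move=> x y; rewrite -!neighborsE.
exists a' => //; rewrite (mem_skeleton HPhi HPos HD') a'P /=.
move/finset.set0Pn: a0 => [x xa]; move/finset.set0Pn: aT => [y ya].
apply/andP; split; apply/finset.set0Pn; first by exists (g x); rewrite a'E.
by exists (g y); rewrite finset.in_setC a'E -finset.in_setC.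
Qed.

Section TwoDomains.
Variables (R : realType) (n : nat) (Phi Pos : {fset 'cV[R]_n}).
Hypothesis HPhi : root_system Phi.
Hypothesis HPos : positive_system Phi Pos.
Variables D D' : {fset 'M[R]_n}.
Hypothesis HD : closed_condorcet_domain Phi Pos D.
Hypothesis HD' : closed_condorcet_domain Phi Pos D'.
Let sk := carrier (skeleton (phi Phi Pos D)).
Let sk' := carrier (skeleton (phi Phi Pos D')).
Let hs := halfspace Phi Pos D.
Let hs' := halfspace Phi Pos D'.

Lemma skeleton_isomorphic_of_graph :
    graph_isomorphic (neighbors Phi Pos (D := D)) (neighbors Phi Pos (D := D')) ->
  skeleton_isomorphic (phi Phi Pos D) (phi Phi Pos D').
Proof.
move=> [g gbij gP]; have [f fK gK] := gbij.
have fbij : bijective f by exists g.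
have fP x y : neighbors Phi Pos (f x) (f y) = neighbors Phi Pos x y.
  by rewrite -gP !gK.
have transport a : exists a', a \in sk ->
    a' \in sk' /\ forall x, (g x \in hs' a') = (x \in hs a).
  have [aS|_] := boolP (a \in sk); last by exists a.
  by have [a' a'S a'E] := skeleton_transport HPhi HPos HD HD' gbij gP aS; exists a'.
have [chi chiP] := choice transport.
have chiE a x : a \in sk -> (x \in hs' (chi a)) = (f x \in hs a).
  by move=> /chiP[_ h]; rewrite -h gK.
exists chi.
  split=> [a /chiP[]//|a b aS bS|b bS].
    rewrite /= !phi_leE; apply/fintype.subsetP/fintype.subsetP => h x.
      by rewrite !chiE //; exact: h.
    by rewrite -[x]fK -![f _ \in _]chiE //; exact: h.
  have [a aS aE] := skeleton_transport HPhi HPos HD' HD fbij fP bS.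
  exists a => //; rewrite peq_skeletonE; apply/eqP/setP => x.
  by rewrite chiE // aE.
move=> a aS; have NaS : - a \in sk by rewrite /sk (skeletonN HPhi HPos HD).
rewrite peqE; apply/eqP/setP => x; rewrite chiE //.
have caP : chi a \in Phi by apply: (skeletonW HPhi HPos HD'); have [] := chiP _ aS.
rewrite /hs (halfspaceN HPhi HPos HD) ?(skeletonW HPhi HPos HD) //.
by rewrite (halfspaceN HPhi HPos HD') // !finset.in_setC -chiE.
Qed.

Section SkeletonIso.
Variable chi : 'cV[R]_n -> 'cV[R]_n.
Hypothesis chi_equiv :
  order_equivalence (skeleton (phi Phi Pos D)) (skeleton (phi Phi Pos D')) chi.
Hypothesis chiN : forall a, a \in sk -> peq (phi Phi Pos D') (chi (- a)) (- chi a).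

(** The element v of D and the element v' of D' make the same choices under
    chi; this relation turns out to be the graph of an isomorphism. *)
Let matched v v' := forall a, a \in sk -> (v \in hs a) = (v' \in hs' (chi a)).

Let skN a : (- a \in sk) = (a \in sk). Proof. exact: (skeletonN HPhi HPos HD). Qed.

Lemma halfspace_chiN a : a \in sk -> hs' (chi (- a)) = ~: hs' (chi a).
Proof.
move=> aS; have [chiS _ _] := chi_equiv.
have /eqP : hs' (chi (- a)) == hs' (- chi a) by rewrite -peqE chiN.
move=> ->; apply: (halfspaceN HPhi HPos HD').
by apply: (skeletonW HPhi HPos HD'); exact: chiS.
Qed.

Lemma matched_injl v' v1 v2 : matched v1 v' -> matched v2 v' -> v1 = v2.
Proof.
move=> m1 m2; apply: (skeleton_determines HPhi HPos HD) => a aS.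
by rewrite [LHS]m1 // [RHS]m2.
Qed.

Lemma matched_injr v v1 v2 : matched v v1 -> matched v v2 -> v1 = v2.
Proof.
have [_ _ chiO] := chi_equiv; move=> m1 m2.
apply: (skeleton_determines HPhi HPos HD') => b /chiO[a aS].
rewrite peq_skeletonE => /eqP <-; exact: etrans (esym (m1 a aS)) (m2 a aS).
Qed.

Lemma matched_preimage v' : exists v, matched v v'.
Proof.
have [chiS chiL _] := chi_equiv.
apply: (skeleton_realize HPhi HPos HD) => [a aS|a b aS bS ha hb].
  by rewrite /= halfspace_chiN // finset.in_setC.
have := chiL _ _ (_ : - b \in sk) aS; rewrite skN => /(_ bS) /= ->.
rewrite phi_leE; apply/fintype.subsetPn; exists v' => //.
by rewrite [halfspace _ _ _ _]halfspace_chiN // finset.in_setC negbK.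
Qed.

(** The choices to realize in D' are the classes of the chi a with a chosen by
    v.  They are well defined because chi reflects the order, total because
    chi reaches every class, and compatible because chi respects both the
    order and negation. *)
Lemma matched_image v : exists v', matched v v'.
Proof.
have [chiS chiL chiO] := chi_equiv.
pose S b := `[< exists a, [/\ a \in sk, v \in hs a & hs' (chi a) = hs' b] >].
have hsN a : a \in sk -> hs (- a) = ~: hs a.
  by move=> aS; apply: (halfspaceN HPhi HPos HD); exact: (skeletonW HPhi HPos HD).
have inj a c : a \in sk -> c \in sk -> hs' (chi a) = hs' (chi c) -> hs a = hs c.
  move=> aS cS e; apply/eqP; rewrite finset.eqEsubset -!phi_leE.
  have := chiL _ _ aS cS; have := chiL _ _ cS aS => /= -> ->.
  by rewrite !phi_leE -/hs' e fintype.subxx.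
have Schi a b : a \in sk -> hs' (chi a) = hs' b -> S b = (v \in hs a).
  move=> aS e; apply/asboolP/idP => [[c [cS vc e']]|va]; last by exists a.
  by rewrite (inj a c) // e e'.
have SN b : b \in sk' -> S (- b) = ~~ S b.
  move=> bS; have [a aS] := chiO _ bS; rewrite peq_skeletonE -/hs' => /eqP e.
  rewrite (Schi a b) // (Schi (- a)) ?skN ?hsN ?finset.in_setC //.
  rewrite halfspace_chiN // e; apply/esym.
  exact: (halfspaceN HPhi HPos HD' (skeletonW HPhi HPos HD' bS)).
have [||v' v'P] := skeleton_realize HPhi HPos HD' (S := S); first exact: SN.
  move=> b1 b2 _ b2S /asboolP[a1 [a1S va1 e1]] /asboolP[a2 [a2S va2 e2]].
  have : ~~ phi_le Phi Pos D (- a2) a1.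
    rewrite phi_leE; apply/fintype.subsetPn; exists v => //.
    by rewrite [halfspace _ _ _ _]hsN // finset.in_setC negbK.
  have := chiL _ _ (_ : - a2 \in sk) a1S; rewrite skN => /(_ a2S) /= ->.
  rewrite !phi_leE [halfspace _ _ _ (chi (- a2))]halfspace_chiN //.
  rewrite (halfspaceN HPhi HPos HD') ?(skeletonW HPhi HPos HD') //.
  by rewrite -/hs' e1 e2.
exists v' => a aS; have := v'P (chi a) (chiS _ aS).
by rewrite (Schi a) // => ->.
Qed.

Lemma graph_isomorphic_of_chi :
  graph_isomorphic (neighbors Phi Pos (D := D)) (neighbors Phi Pos (D := D')).
Proof.
have [_ _ chiO] := chi_equiv.
have [g gm] := choice matched_image; have [f fm] := choice matched_preimage.
have fK : cancel g f by move=> v; apply: (matched_injl (v' := g v)).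
have gK : cancel f g by move=> v; apply: (matched_injr (v := f v)).
have gB x z y : between (halfspaces Phi Pos D') (g x) (g z) (g y) =
                between (halfspaces Phi Pos D) x z y.
  apply/(between_skeletonP HPhi HPos HD')/(between_skeletonP HPhi HPos HD) => h.
    move=> a aS; have [aS' _ _] := chi_equiv.
    by have := h _ (aS' _ aS); rewrite -!gm.
  move=> b /chiO[a aS]; rewrite peq_skeletonE => /eqP <-.
  by rewrite -!gm //; exact: h.
exists g; first by exists f.
move=> x y; rewrite !neighborsE /adjacent (can_eq fK); congr (_ && ~~ _).
apply/existsP/existsP => -[z].
  by exists (f z); rewrite -gB gK -!(can_eq fK) gK.
by exists (g z); rewrite gB !(can_eq fK).
Qed.

End SkeletonIso.

End TwoDomains.

Theorem theorem1p6 (R : realType) (n : nat) (Phi Pos : {fset 'cV[R]_n})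
    (HPhi : root_system Phi) (HPos : positive_system Phi Pos)
    (D D' : {fset 'M[R]_n})
    (HD : closed_condorcet_domain Phi Pos D)
    (HD' : closed_condorcet_domain Phi Pos D') :
  graph_isomorphic (neighbors Phi Pos (D := D)) (neighbors Phi Pos (D := D')) <->
  skeleton_isomorphic (phi Phi Pos D) (phi Phi Pos D').
Proof.
split; first exact: skeleton_isomorphic_of_graph.
by move=> [chi chi_equiv chiN]; exact: graph_isomorphic_of_chi chi_equiv chiN.
Qed.
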